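(* Let $G$ be a connected block graph, let $v\in V(G)$, and let $k$ be an integer with $1\le k\le n(G)$. If $T_1$ is a Steiner $k$-ecc $v$-tree in $T(v,G)$, then $T_1$ is also a Steiner $k$-ecc $v$-tree in $G$.
   Context: All graphs are finite, simple and undirected; $n(H)$ and $m(H)$ denote the number of vertices and edges of a graph $H$. A block graph is a graph in which every block is a clique. For $v\in V(G)$ and a block $B$ of $G$, ${\rm Near}_G(v,B)$ is the (unique) vertex of $B$ nearest to $v$ in $G$. The graph $T(v,G)$ is obtained from $G$ by removing, for every block $B$ of $G$, every edge of $B$ not incident with ${\rm Near}_G(v,B)$; it is a spanning tree of $G$. For a graph $H$ and $S\subseteq V(H)$, a Steiner $S$-tree is a connected subgraph of $H$ containing all vertices of $S$ with minimum number of edges. The Steiner $k$-eccentricity of $v$ in $H$ is ${\rm ecc}_k(v,H)=\max\{m(T): T \text{ is a Steiner } S\text{-tree in } H,\ S\subseteq V(H),\ |S|=k,\ v\in S\}$. A Steiner $k$-ecc $v$-tree in $H$ is a Steiner $S$-tree $T$ in $H$ with $|S|=k$, $v\in S$ and $m(T)={\rm ecc}_k(v,H)$. *)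

(* Defs.v *)
From HB Require Import structures.
From mathcomp Require Import all_boot.

Set Implicit Arguments.
Unset Strict Implicit.
Unset Printing Implicit Defensive.

(* Finite simple graphs whose vertices are taken from a fixed finite type V.
   The vertex set is part of the data, so that a graph, its blocks, its
   spanning trees and its Steiner trees all have the same type; edges are
   two-element sets of vertices. *)
Definition wf_graph (V : finType) (H : {set V} * {set {set V}}) : bool :=
  [forall f in H.2, (#|f| == 2) && (f \subset H.1)].

Record graph (V : finType) : Type := Graph {
  graph_val : {set V} * {set {set V}};
  graph_valP : wf_graph graph_val }.

HB.instance Definition _ (V : finType) := [isSub for @graph_val V].
HB.instance Definition _ (V : finType) := [Finite of graph V by <:].

Definition verts (V : finType) (H : graph V) : {set V} := (graph_val H).1.
Definition edges (V : finType) (H : graph V) : {set {set V}} := (graph_val H).2.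

Definition n_verts (V : finType) (H : graph V) : nat := #|verts H|.
Definition n_edges (V : finType) (H : graph V) : nat := #|edges H|.

Definition adj (V : finType) (H : graph V) : rel V :=
  [rel x y | [set x; y] \in edges H].

Definition subgraph (V : finType) (H K : graph V) : bool :=
  (verts H \subset verts K) && (edges H \subset edges K).

(* The graph without vertices is not connected. *)
Definition connected (V : finType) (H : graph V) : bool :=
  (verts H != set0) &&
  [forall x in verts H, forall y in verts H, connect (adj H) x y].

(* A vertex separating two other vertices of the same component. *)
Definition cut_vertex (V : finType) (H : graph V) (x : V) : bool :=
  [exists y, exists z,
    [&& y != x, z != x, connect (adj H) y z &
        ~~ connect [rel a b | [&& adj H a b, a != x & b != x]] y z]].

Definition no_cut_vertex (V : finType) (H : graph V) : bool :=
  [forall x in verts H, ~~ cut_vertex H x].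

Definition is_block (V : finType) (G B : graph V) : bool :=
  [&& subgraph B G, connected B, no_cut_vertex B &
      [forall B' : graph V,
        [&& subgraph B' G, connected B', no_cut_vertex B' & subgraph B B']
          ==> (B' == B)]].

Definition is_clique (V : finType) (H : graph V) : bool :=
  [forall x in verts H, forall y in verts H, (x != y) ==> adj H x y].

Definition block_graph (V : finType) (G : graph V) : bool :=
  [forall B : graph V, is_block G B ==> is_clique B].

(* The least number of edges of a walk from x to y, with #|V| playing the role
   of infinity: vertices joined by a walk are joined by one with fewer than
   #|V| edges. *)
Definition dist (V : finType) (G : graph V) (x y : V) : nat :=
  find (fun n => [exists p : n.-tuple V, path (adj G) x p && (last x p == y)])
       (iota 0 #|V|).

(* The default value v is never used when B is nonempty. *)
Definition near (V : finType) (G : graph V) (v : V) (B : graph V) : V :=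
  odflt v [pick x in verts B | [forall y in verts B, dist G v x <= dist G v y]].

Definition near_edges (V : finType) (v : V) (G : graph V) : {set {set V}} :=
  edges G :\: [set f | [exists B : graph V,
    [&& is_block G B, f \in edges B & near G v B \notin f]]].

Lemma wf_near_tree (V : finType) (v : V) (G : graph V) :
  wf_graph (verts G, near_edges v G).
Proof.
apply/forall_inP => f /setDP[fG _]; exact: (forall_inP (graph_valP G) f fG).
Qed.

(* The graph T(v,G). *)
Definition near_tree (V : finType) (v : V) (G : graph V) : graph V :=
  Graph (wf_near_tree v G).

Definition connects (V : finType) (H : graph V) (S : {set V}) (T : graph V) :
  bool := [&& subgraph T H, connected T & S \subset verts T].

Definition steiner_tree (V : finType) (H : graph V) (S : {set V})
    (T : graph V) : bool :=
  connects H S T &&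
  [forall T' : graph V, connects H S T' ==> (n_edges T <= n_edges T')].

(* T is a Steiner S-tree in H for some k-element set S of vertices of H
   containing v. *)
Definition steiner_kv_tree (V : finType) (k : nat) (v : V) (H T : graph V) :
  bool :=
  [exists S : {set V},
    [&& S \subset verts H, #|S| == k, v \in S & steiner_tree H S T]].

Definition ecc (V : finType) (k : nat) (v : V) (H : graph V) : nat :=
  \max_(T : graph V | steiner_kv_tree k v H T) n_edges T.

Definition steiner_ecc_tree (V : finType) (k : nat) (v : V) (H T : graph V) :
  bool :=
  steiner_kv_tree k v H T && (n_edges T == ecc k v H).

(* Main.v *)
Require Import Defs.
From mathcomp Require Import all_boot.

Set Implicit Arguments.
Unset Strict Implicit.
Unset Printing Implicit Defensive.

(** Let p precede x on a shortest path from v to x.  Every walk from v to x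
    meets p: otherwise the vertex before p on the path would lie on a cycle
    with p and x, hence in a common block, hence be adjacent to x.  So p is the
    unique nearest vertex to v of every block containing px, the edge px
    survives in T(v,G), and any connected subgraph K of G through v contains
    the parent p of each of its vertices x <> v.  Replacing the edges of K by
    these |K| - 1 parent edges gives a connected subgraph of T(v,G) on the same
    vertices with no more edges.  Hence sets containing v have the same Steiner
    distance in G and in T(v,G). *)

Section Graphs.
Variable V : finType.
Implicit Types (G H K B T : graph V) (S : {set V}) (v x y p : V).

(** * Edges, subgraphs and walks *)

Lemma edge_card2 G f : f \in edges G -> #|f| = 2.
Proof. by move=> fG; case/andP: (forall_inP (graph_valP G) f fG) => /eqP. Qed.

Lemma edge_sub_verts G f : f \in edges G -> f \subset verts G.
Proof. by move=> fG; case/andP: (forall_inP (graph_valP G) f fG). Qed.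

Lemma adj_sym G : symmetric (adj G).
Proof. by move=> x y; rewrite /adj /= setUC. Qed.

Lemma adj_verts G x y : adj G x y -> (x \in verts G) && (y \in verts G).
Proof.
by move/edge_sub_verts/subsetP => s; rewrite !s // !inE eqxx ?orbT.
Qed.

Lemma adj_neq G x y : adj G x y -> x != y.
Proof. by move/edge_card2; rewrite cards2; case: (x == y). Qed.

Lemma subgraph_refl G : subgraph G G.
Proof. by rewrite /subgraph !subxx. Qed.

Lemma subgraph_trans H G K : subgraph G H -> subgraph H K -> subgraph G K.
Proof.
move=> /andP[a b] /andP[c d].
by rewrite /subgraph (subset_trans a c) (subset_trans b d).
Qed.

Lemma subgraph_adj H G x y : subgraph H G -> adj H x y -> adj G x y.
Proof. by case/andP=> _ /subsetP; apply. Qed.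

Lemma path_verts G x s : x \in verts G -> path (adj G) x s ->
  {subset x :: s <= verts G}.
Proof.
move=> xG; elim: s x xG => [|y s IH] x xG /=.
  by move=> _ z; rewrite inE => /eqP->.
case/andP=> xy /IH; case/andP: (adj_verts xy) => _ yG /(_ yG) ys z.
by rewrite inE => /predU1P[->//|/ys].
Qed.

Lemma connected_connect G x y :
  connected G -> x \in verts G -> y \in verts G -> connect (adj G) x y.
Proof. by case/andP=> _ /forall_inP h xG; apply/forall_inP/h. Qed.

(** * Distances and parents *)

Lemma dist_le_size G x s : path (adj G) x s -> dist G x (last x s) <= size s.
Proof.
move=> xs; rewrite leqNgt; apply/negP => lt.
(* [find] never exceeds the list length [#|V|], so [size s] is a genuine index at which the search
   had not yet succeeded. *)
have ltV : size s < #|V|.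
  by apply: leq_trans lt _; rewrite -[X in _ <= X](size_iota 0) find_size.
move/(before_find 0): lt; rewrite nth_iota // add0n => /existsP[].
by exists (in_tuple s); rewrite /= xs eqxx.
Qed.

Lemma dist_shortest_path G x y : connect (adj G) x y ->
  exists s, [/\ path (adj G) x s, last x s = y & size s = dist G x y].
Proof.
case/connectP=> s0 xs0 ->; case/shortenP: xs0 => s xs us _.
(* A walk without repeated vertices has fewer than [#|V|] edges, so the search defining [dist]
   succeeds. *)
have ltV : size s < #|V|.
  by have := max_card (mem (x :: s)); rewrite (card_uniqP us).
set P := fun n => [exists p : n.-tuple V,
  path (adj G) x p && (last x p == last x s)].
have hasP : has P (iota 0 #|V|).
  apply/hasP; exists (size s); first by rewrite mem_iota.
  by apply/existsP; exists (in_tuple s); rewrite /= xs eqxx.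
have := nth_find 0 hasP; move: hasP; rewrite has_find size_iota => lt.
rewrite nth_iota // add0n => /existsP[t /andP[xt /eqP lt']].
by exists t; rewrite size_tuple.
Qed.

Lemma dist_step G v x y : connect (adj G) v x -> adj G x y ->
  dist G v y <= (dist G v x).+1.
Proof.
case/dist_shortest_path=> s [vs <- <-] xy.
have := @dist_le_size G v (rcons s y).
by rewrite rcons_path vs xy last_rcons size_rcons; apply.
Qed.

(** For [p] reachable from [v], this says that [p] precedes [x] on some shortest walk from [v],
    without carrying the walk along. *)
Definition parent G v p x := adj G p x && (dist G v x == (dist G v p).+1).

Lemma parent_exists G v x : connect (adj G) v x -> x != v ->
  exists2 p, connect (adj G) v p & parent G v p x.
Proof.
case/dist_shortest_path=> s; case/lastP: s => [|s y] [].
  by move=> _ /= ->; rewrite eqxx.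
rewrite rcons_path last_rcons size_rcons => /andP[vs sx] yx szE xv.
rewrite {}yx in sx.
have cp : connect (adj G) v (last v s) by apply/connectP; exists s.
exists (last v s) => //; rewrite /parent sx eqn_leq dist_step //.
by rewrite -szE ltnS dist_le_size.
Qed.

(** Sending each vertex other than a root [r] to the edge joining it to a chosen parent is
    injective. *)
Lemma card_verts_le_edges G : connected G -> #|verts G| <= (n_edges G).+1.
Proof.
move=> cG; case/andP: (cG) => /set0Pn[r rG] _.
(* The implication, with a dummy witness elsewhere, makes the choice function [par] total. *)
have ex x : exists p, (x \in verts G :\ r) ==> parent G r p x.
  case: (boolP (x \in _)) => [|_]; last by exists x.
  case/setD1P=> xr xG.
  by have [p _ px] := parent_exists (connected_connect cG rG xG) xr; exists p.
pose par x := xchoose (ex x).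
have parP x : x \in verts G :\ r -> parent G r (par x) x.
  by apply/implyP/(xchooseP (ex x)).
rewrite (cardsD1 r) rG add1n ltnS /n_edges.
rewrite -(@card_in_imset _ _ (fun x => [set par x; x])).
  by apply/subset_leq_card/subsetP => f /imsetP[x /parP/andP[h _] ->].
(* Distinct vertices with the same edge would be parents of each other, each farther from [r] than
   the other. *)
move=> x y /parP/andP[_ /eqP dx] /parP/andP[_ /eqP dy] /setP E.
have := E x; have := E y; rewrite !inE !eqxx !orbT.
case/predU1P=> [yE|/eqP//]; move/esym/predU1P=> [xE|/eqP//].
rewrite -yE in dx; rewrite -xE in dy.
have lt_yx : dist G r y < dist G r x by rewrite dx.
have lt_xy : dist G r x < dist G r y by rewrite dy.
by case: ltngtP lt_yx lt_xy.
Qed.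

(** * Induced subgraphs, in particular on the vertices of a cycle *)

Section Induced.
Variables (G : graph V) (S : {set V}).

Lemma wf_induced : wf_graph (S, [set f in edges G | f \subset S]).
Proof.
by apply/forall_inP=> f; rewrite inE => /andP[/edge_card2-> ->].
Qed.

Definition induced : graph V := Graph wf_induced.

Lemma adj_induced x y :
  adj induced x y = [&& adj G x y, x \in S & y \in S].
Proof. by rewrite /adj /= /edges /= inE subUset !sub1set. Qed.

Lemma induced_subgraph : S \subset verts G -> subgraph induced G.
Proof.
move=> sS; rewrite /subgraph sS; apply/subsetP=> f.
by rewrite /edges inE => /andP[].
Qed.

End Induced.

Section Cycle.
Variables (G : graph V) (c : seq V).
Hypotheses (cyc : cycle (adj G) c) (uc : uniq c).

Let C := induced G [set x in c].

(** Rotating [c] to start at [x] opens the cycle there; [s] is the path left when [x] is deleted. *)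
Let cycle_from x : x \in c ->
  exists s, [/\ path (adj C) x (rcons s x), x \notin s
              & forall y, (y \in c) = (y \in x :: s)].
Proof.
move=> xc; case: (rot_to xc) => i s E.
have mem y : (y \in c) = (y \in x :: s) by rewrite -E mem_rot.
exists s; split=> //; last by move: uc; rewrite -(rot_uniq i) E => /andP[].
move: cyc; rewrite -(rot_cycle i) E /=.
apply: (@sub_in_path _ [in c]); last first.
  by apply/allP=> y; rewrite inE mem_rcons mem !inE orbA orbb.
by move=> y z yc zc yz; rewrite adj_induced yz !inE; apply/and3P.
Qed.

Lemma cycle_connected x : x \in c -> connected C.
Proof.
move=> xc; apply/andP; split; first by apply/set0Pn; exists x; rewrite inE.
apply/forall_inP=> a; rewrite inE => /cycle_from[s [pa _ mem]].
apply/forall_inP=> b; rewrite inE mem => bs.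
by apply: (path_connect pa); rewrite inE mem_rcons bs orbT.
Qed.

(** Deleting [w] from the cycle leaves a path through all its other vertices; chords can only add
    connections. *)
Lemma cycle_no_cut_vertex : no_cut_vertex C.
Proof.
apply/forall_inP=> w; rewrite inE => wc.
apply/negP=> /existsP[y /existsP[z /and4P[yw zw yz /negP]]]; apply.
(* [cut_vertex] quantifies over all of [V]; a vertex outside [C] has no edge in it and reaches only
   itself. *)
have [yc|ync] := boolP (y \in verts C); last first.
  case/connectP: yz => -[_ ->|u q /= /andP[/adj_verts/andP[yC _]]].
    exact: connect0.
  by rewrite yC in ync.
have zc : z \in verts C.
  by case/connectP: yz => q yq ->; apply: (path_verts yc yq (mem_last y q)).
have [s [pw ws mem]] := cycle_from wc.
have inS a : a \in verts C -> a != w -> a \in s.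
  by rewrite inE mem inE => /predU1P[->|//]; rewrite eqxx.
have {inS yc zc} [ys zs] := (inS _ yc yw, inS _ zc zw).
case: s ys zs pw ws {mem} => [//|h t] yt zt; rewrite rcons_cons /=.
case/andP=> _; rewrite rcons_path => /andP[pt _] wt.
set r := [rel a b | _].
have symr : symmetric r.
  by move=> a b; rewrite /r /= adj_sym; congr (_ && _); rewrite andbC.
have pr : path r h t.
  apply: (@sub_in_path _ (predC1 w) (adj C)) pt => [a b aw bw ab|].
    by apply/and3P; split.
  by apply/allP=> a at_; apply: contraNneq wt => <-.
rewrite (connect_trans _ (path_connect pr zt)) //.
by rewrite (sym_connect_sym symr) (path_connect pr).
Qed.

End Cycle.

(** * Blocks and cycles of a block graph *)

Lemma sub_block G H :
  subgraph H G -> connected H -> no_cut_vertex H ->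
  exists2 B, is_block G B & subgraph H B.
Proof.
move=> sH cH nH.
pose P B := [&& subgraph B G, connected B, no_cut_vertex B & subgraph H B].
have PH : P H by rewrite /P sH cH nH subgraph_refl.
(* Vertices and edges are counted together, so a supergraph that is no larger must agree in both
   components. *)
case: (arg_maxnP (fun B => #|verts B| + #|edges B|) PH) => B.
case/and4P=> sB cB nB sHB maxB; exists B => //.
rewrite /is_block sB cB nB /=; apply/forallP=> B'; apply/implyP.
case/and4P=> sB' cB' nB' BB'; have [sv se] := andP BB'.
have := maxB B'; rewrite /P sB' cB' nB' (subgraph_trans sHB BB') => /(_ isT).
have [lv le] := (subset_leq_card sv, subset_leq_card se) => leB.
have /eqP vE : verts B == verts B'.
  by rewrite eqEcard sv -(leq_add2r #|edges B'|) (leq_trans leB) // leq_add2l.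
have /eqP eE : edges B == edges B'.
  by rewrite eqEcard se -(leq_add2l #|verts B'|) (leq_trans leB) // leq_add2r.
rewrite -val_eqE /=; move: vE eE; rewrite /verts /edges.
by case: (graph_val B) (graph_val B') => [? ?] [? ?] /= -> ->.
Qed.

Lemma block_clique G B x y : block_graph G -> is_block G B ->
  x \in verts B -> y \in verts B -> x != y -> adj G x y.
Proof.
move=> /forallP/(_ B)/implyP bG bB xB yB xy.
case/and4P: (bB) => sB _ _ _; apply: (subgraph_adj sB).
by apply: (implyP (forall_inP (forall_inP (bG bB) x xB) y yB)).
Qed.

(** The graph induced on a cycle is connected without cut vertex, so it lies in a block, which is a
    clique. *)
Lemma cycle_clique G c x y : block_graph G -> cycle (adj G) c -> uniq c ->
  x \in c -> y \in c -> x != y -> adj G x y.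
Proof.
move=> bG cyc uc xc yc.
have sc : [set z in c] \subset verts G.
  apply/subsetP=> z; rewrite inE => zc.
  by case/andP: (adj_verts (next_cycle cyc zc)).
have [B bB /andP[/subsetP sB _]] := sub_block (induced_subgraph sc)
  (cycle_connected cyc uc xc) (cycle_no_cut_vertex cyc uc).
by apply: (block_clique bG bB); apply: sB; rewrite inE.
Qed.

(** * Parents separate and are nearest in their blocks *)

Lemma parent_separates G v p x s : block_graph G -> connect (adj G) v p ->
  parent G v p x -> path (adj G) v s -> last v s = x -> p \in v :: s.
Proof.
move=> bG vp /andP[px /eqP dx] vs sx; apply: contraT => pNs.
have pv : p != v by move: pNs; rewrite inE negb_or => /andP[].
(* A cycle through [q], [p] and [x] will make [q] adjacent to [x], although [x] is two steps farther
   from [v] than [q]. *)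
have [q vq /andP[qp /eqP dp]] := parent_exists vp pv.
pose e := [rel a b | [&& adj G a b, a != p & b != p]].
have syme : symmetric e.
  by move=> a b; rewrite /e /= adj_sym; congr (_ && _); rewrite andbC.
have avoid t : path (adj G) v t -> p \notin v :: t -> path e v t.
  move=> vt pt.
  apply: (@sub_in_path _ (predC1 p) (adj G)) vt => [a b ap bp ab|].
    by apply/and3P; split.
  by apply/allP=> a at_; apply: contraNneq pt => <-.
have evx : connect e v x by apply/connectP; exists s; rewrite ?avoid.
(* A shortest walk to [q] cannot visit [p], which is farther from [v]. *)
have evq : connect e v q.
  have [t [vt tq szt]] := dist_shortest_path vq.
  apply/connectP; exists t => //; apply: avoid => //.
  rewrite inE negb_or pv; apply/negP => pt.
  case/splitPr: pt vt szt {tq} => t1 t2.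
  rewrite -cat_rcons cat_path => /andP[vt1 _] szt.
  have := dist_le_size vt1; rewrite last_rcons dp -szt size_cat.
  by rewrite ltnNge leq_addr.
have /connectP[t0 xt0 qE] : connect e x q.
  by apply: connect_trans evq; rewrite (sym_connect_sym syme).
(* Once made simple, the walk from [x] to [q] avoiding [p] closes to a cycle through the edges [qp]
   and [px]. *)
case/shortenP: xt0 qE => t xt ut _ qE.
have xp : x != p by rewrite eq_sym (adj_neq px).
have pt : p \notin x :: t.
  rewrite inE negb_or eq_sym xp.
  elim: t x xt {ut qE px dx sx evx xp} => //= a t IH x.
  by case/andP=> /and3P[_ _ ap] /IH; rewrite inE negb_or eq_sym ap.
have cyc : cycle (adj G) (p :: x :: t).
  rewrite /= px rcons_path -qE qp andbT.
  by apply: sub_path xt => a b /andP[].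
have uc : uniq (p :: x :: t) by rewrite cons_uniq pt.
have xc : x \in p :: x :: t by rewrite !inE eqxx orbT.
have qc : q \in p :: x :: t by rewrite inE qE mem_last orbT.
have lt_qx : (dist G v q).+1 < dist G v x by rewrite dx dp.
have qx : q != x by apply: contraTneq lt_qx => ->; rewrite -leqNgt leqnSn.
have := dist_step vq (cycle_clique bG cyc uc qc xc qx).
by rewrite leqNgt lt_qx.
Qed.

(** An edge is removed only on account of a block containing it, so it suffices that [p] is the
    [near] vertex of every block containing [px]. *)
Lemma parent_edge_near G v p x : block_graph G -> connect (adj G) v p ->
  parent G v p x -> [set p; x] \in near_edges v G.
Proof.
move=> bG vp par; have [px /eqP dx] := andP par.
apply/setDP; split=> //; rewrite inE; apply/existsP=> -[B /and3P[bB pxB]].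
have /andP[pB xB] : (p \in verts B) && (x \in verts B) by apply: adj_verts.
have pmin y : y \in verts B -> y != p -> dist G v p < dist G v y.
  move=> yB yp; have [->|yx] := eqVneq y x; first by rewrite dx.
  have py : connect (adj G) v y.
    apply: connect_trans vp (connect1 _).
    by apply: (block_clique bG bB) => //; rewrite eq_sym.
  have [s [vs sy <-]] := dist_shortest_path py.
  (* The shortest walk to [y], prolonged by the edge [yx], must meet [p] before [x], hence strictly
     before its vertex [y]. *)
  have : p \in v :: rcons s x.
    apply: (parent_separates bG vp par); last by rewrite last_rcons.
    by rewrite rcons_path vs sy (block_clique bG bB yB xB).
  rewrite -rcons_cons mem_rcons in_cons (negPf (adj_neq px)) /= => ps.
  case/splitPl: ps vs sy => s1 s2 s1p.
  rewrite cat_path last_cat size_cat => /andP[/dist_le_size le1 _] sy.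
  rewrite s1p in le1 sy; apply: leq_ltn_trans le1 _.
  rewrite -[X in X < _]addn0 ltn_add2l lt0n size_eq0.
  by apply: contraNneq yp => s2E; rewrite -sy s2E.
apply/negP; rewrite negbK.
(* [pick] may return any minimiser, so the strict inequality in [pmin] is what forces [p]; the other
   branch rules out the default value. *)
rewrite /near; case: pickP => [u /andP[uB /forall_inP/(_ p pB) le_up]|/(_ p)].
  have [->|/(pmin u uB)] := eqVneq u p; first by rewrite !inE eqxx.
  by rewrite ltnNge le_up.
rewrite pB => /negP[]; apply/forall_inP=> y yB.
by have [->//|/(pmin y yB)/ltnW] := eqVneq y p.
Qed.

(** * Replacing a connected subgraph by parent edges *)

Lemma near_tree_subgraph G v : subgraph (near_tree v G) G.
Proof. by rewrite /subgraph subxx; apply: subsetDl. Qed.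

Lemma wf_parents K (par : V -> V) v :
  {in verts K :\ v, forall x, (par x \in verts K) && (par x != x)} ->
  wf_graph (verts K, [set [set par x; x] | x in verts K :\ v]).
Proof.
move=> parK; apply/forall_inP=> f /imsetP[x xK ->] /=.
have /andP[pK px] := parK x xK.
by rewrite cards2 px subUset !sub1set pK; case/setD1P: xK => _ ->.
Qed.

Lemma respan_in_near_tree G K v : block_graph G -> connected G ->
  subgraph K G -> connected K -> v \in verts K ->
  exists T, [/\ subgraph T (near_tree v G), connected T, verts T = verts K
              & n_edges T <= n_edges K].
Proof.
move=> bG cG sK cK vK; have /andP[/subsetP vKG _] := sK.
have vG := vKG v vK.
have ex x : exists p, (x \in verts K :\ v) ==>
    [&& p \in verts K, parent G v p x & [set p; x] \in near_edges v G].
  case: (boolP (x \in _)) => [|_]; last by exists x.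
  case/setD1P=> xv xK; have vx := connected_connect cG vG (vKG x xK).
  have [p vp px] := parent_exists vx xv; exists p; rewrite px.
  rewrite (parent_edge_near bG vp px) andbT /= andbT.
  (* A walk inside [K] is also a walk in [G], so it meets [p]; this places [p] in [K]. *)
  have /connectP[s vs sx] := connected_connect cK vK xK.
  apply: (path_verts vK vs); apply: (parent_separates bG vp px) => //.
  by apply: sub_path vs => a b; apply: subgraph_adj.
pose par x := xchoose (ex x).
have parP x : x \in verts K :\ v -> [&& par x \in verts K,
    parent G v (par x) x & [set par x; x] \in near_edges v G].
  by apply/implyP/(xchooseP (ex x)).
have wfT : wf_graph (verts K, [set [set par x; x] | x in verts K :\ v]).
  apply: wf_parents => x /parP/and3P[-> /andP[px _] _].
  by rewrite (adj_neq px).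
exists (Graph wfT); split=> //.
- rewrite /subgraph; apply/andP; split; first by apply/subsetP.
  by apply/subsetP=> f /imsetP[x /parP/and3P[_ _ xn] ->].
(* Parents are strictly closer to [v], so induction on the distance leads back to the root. *)
- have toV x : x \in verts K -> connect (adj (Graph wfT)) v x.
    have [n] := ubnP (dist G v x); elim: n x => // n IH x ltn xK.
    have [->|xv] := eqVneq x v; first exact: connect0.
    have xKv : x \in verts K :\ v by rewrite !inE xv.
    have /and3P[pK /andP[_ /eqP dx] _] := parP x xKv.
    apply: connect_trans (IH _ _ pK) (connect1 _); first by rewrite -ltnS -dx.
    by apply/imsetP; exists x.
  apply/andP; split; first by apply/set0Pn; exists v.
  apply/forall_inP=> x xK; apply/forall_inP=> y yK.
  apply: connect_trans (toV y yK).
  by rewrite (sym_connect_sym (@adj_sym _)) toV.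
- have := card_verts_le_edges cK; rewrite (cardsD1 v) vK ltnS.
  by apply: leq_trans; apply: leq_imset_card.
Qed.

(** * Steiner trees in [G] and in [near_tree v G] *)

Lemma connects_subgraph H G S T :
  subgraph H G -> connects H S T -> connects G S T.
Proof.
by move=> sH /and3P[sT cT ST]; rewrite /connects (subgraph_trans sT sH) cT.
Qed.

Section SteinerTrees.
Variables (G : graph V) (v : V).
Hypotheses (cG : connected G) (bG : block_graph G).

(** Membership of [v] in [S] puts the root into [K], as respanning requires. *)
Lemma connects_near_tree S K : v \in S -> connects G S K ->
  exists2 T, connects (near_tree v G) S T & n_edges T <= n_edges K.
Proof.
move=> vS /and3P[sK cK SK].
have [T [sT cT vT leT]] :=
  respan_in_near_tree bG cG sK cK (subsetP SK v vS).
by exists T; rewrite // /connects sT cT vT.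
Qed.

Lemma steiner_tree_near_tree S T : v \in S ->
  steiner_tree (near_tree v G) S T -> steiner_tree G S T.
Proof.
move=> vS /andP[cT /forall_inP minT]; apply/andP; split.
  exact: connects_subgraph (near_tree_subgraph G v) cT.
apply/forall_inP=> K /(connects_near_tree vS)[T' /minT leT].
exact: leq_trans.
Qed.

Lemma steiner_kv_tree_near_tree k T :
  steiner_kv_tree k v (near_tree v G) T -> steiner_kv_tree k v G T.
Proof.
case/existsP=> S /and4P[SG kS vS sT]; apply/existsP; exists S.
by rewrite SG kS vS steiner_tree_near_tree.
Qed.

(** [K] itself may use edges missing from [near_tree v G], so only its number of edges is carried
    over. *)
Lemma steiner_kv_tree_respan k K : steiner_kv_tree k v G K ->
  exists2 T, steiner_kv_tree k v (near_tree v G) T & n_edges T = n_edges K.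
Proof.
case/existsP=> S /and4P[SG kS vS /andP[cK /forall_inP minK]].
have [T cT leT] := connects_near_tree vS cK.
have minT T' : connects (near_tree v G) S T' -> n_edges K <= n_edges T'.
  by move/(connects_subgraph (near_tree_subgraph G v))/minK.
exists T; last by apply/eqP; rewrite eqn_leq leT minT.
apply/existsP; exists S; rewrite SG kS vS /steiner_tree cT.
by apply/forall_inP=> T' /minT; apply: leq_trans.
Qed.

Lemma ecc_near_tree k : ecc k v (near_tree v G) = ecc k v G.
Proof.
apply/eqP; rewrite eqn_leq; apply/andP; split; apply/bigmax_leqP=> T.
  by move/steiner_kv_tree_near_tree; apply: leq_bigmax_cond.
case/steiner_kv_tree_respan=> T' sT' <-; exact: leq_bigmax_cond.
Qed.

End SteinerTrees.
End Graphs.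

Theorem theorem2p2 (V : finType) (G : graph V) (v : V) (k : nat)
    (T1 : graph V) :
  connected G -> block_graph G ->
  v \in verts G ->
  1 <= k <= n_verts G ->
  steiner_ecc_tree k v (near_tree v G) T1 ->
  steiner_ecc_tree k v G T1.
Proof.
move=> cG bG _ _ /andP[sT eT].
by rewrite /steiner_ecc_tree steiner_kv_tree_near_tree // -ecc_near_tree.
Qed.
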